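(* Let $N\ge 2$, $1<p<\infty$, $m,q>0$, $0\le\alpha<p-1$, $0\le\beta\le m$, and set $\delta:=(p-1-\alpha)(p-1-\beta)-mq$. Assume $\delta<0$ and $\alpha_0>0$, where $$\alpha_0=\frac{1+\beta-p(m+1)}{\delta},\qquad \beta_0=-\frac{p(p-1-\alpha)+q}{\delta},\qquad \gamma_0=1+\beta_0 .$$ Let $(u,v)$ be a nonconstant positive radial solution of $$\Delta_p u=v^m|\nabla u|^\alpha,\qquad \Delta_p v=v^\beta|\nabla u|^q\qquad\text{in } B_1$$ that blows up at the boundary of $B_1$, i.e. $v(r)\to\infty$ as $r\to1^-$ (with $u(1^-)$ finite or infinite). Then $$u'(r)\sim\frac{\lambda}{(1-r)^{\alpha_0}}\qquad\text{and}\qquad v(r)\sim\frac{\mu}{(1-r)^{\beta_0}}\qquad\text{as } r\to1^-,$$ where $$\lambda=\left(\gamma_0(p-1)\beta_0^{p-1}\big(\alpha_0(p-1)\big)^{\frac{p-1-\beta}{m}}\right)^{-\frac{m}{\delta}},\qquad \mu=\left(\gamma_0(p-1)\beta_0^{p-1}\big(\alpha_0(p-1)\big)^{\frac{q}{p-1-\alpha}}\right)^{-\frac{p-1-\alpha}{\delta}} .$$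
   Context: $B_1\subset\mathbb{R}^N$ is the open ball of radius $1$ centered at the origin and $\Delta_p w=\mathrm{div}(|\nabla w|^{p-2}\nabla w)$. A nonconstant positive radial solution of the system in $B_1$ is a pair $(u,v)$ of positive, radially symmetric functions in $C^1(B_1)\cap C^2(B_1\setminus\{0\})$ that satisfy the system and such that neither $u$ nor $v$ is constant in any neighbourhood of the origin. Radial functions are written as functions of $r=|x|$, and $'$ denotes $d/dr$. $f\sim g$ as $r\to1^-$ means $f(r)/g(r)\to1$. *)

(* Defs.v *)
From HB Require Import structures.
From mathcomp Require Import all_boot all_order all_algebra.
From mathcomp Require Import all_classical all_reals all_analysis.

Set Implicit Arguments.
Unset Strict Implicit.
Unset Printing Implicit Defensive.
Import Order.TTheory GRing.Theory Num.Theory.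
Import numFieldNormedType.Exports.
Local Open Scope classical_set_scope.
Local Open Scope ring_scope.

(* The library norm `|x| on 'rV[R]_N is the sup norm, hence a separate
   Euclidean norm; both induce the same topology. *)
Definition enorm (R : realType) (N : nat) (x : 'rV[R]_N) : R :=
  Num.sqrt (\sum_(i < N) x ord0 i ^+ 2).

Definition unit_ball (R : realType) (N : nat) : set 'rV[R]_N :=
  [set x | enorm x < 1].

Definition punctured_unit_ball (R : realType) (N : nat) : set 'rV[R]_N :=
  [set x | enorm x < 1 /\ x != 0].

Definition basis_vec (R : realType) (N : nat) (i : 'I_N) : 'rV[R]_N :=
  delta_mx ord0 i.

Definition partial (R : realType) (N : nat) (i : 'I_N) (w : 'rV[R]_N -> R) :
    'rV[R]_N -> R :=
  fun x => 'D_(basis_vec R i) w x.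

(* Intended for open U. *)
Fixpoint class_C (R : realType) (N k : nat) (U : set 'rV[R]_N)
    (w : 'rV[R]_N -> R) : Prop :=
  match k with
  | 0 => {in U, continuous w}
  | k'.+1 => {in U, continuous w} /\
      forall i : 'I_N, (forall x, U x -> derivable w x (basis_vec R i)) /\
                       class_C k' U (partial i w)
  end.

Definition grad (R : realType) (N : nat) (w : 'rV[R]_N -> R) (x : 'rV[R]_N) :
    'rV[R]_N :=
  \row_(i < N) partial i w x.

(* At a critical point of w this is 0 for every p > 1, because
   0 `^ (p - 2) is 0 for p <> 2 and 1 for p = 2: it is the continuous
   extension of |grad w|^(p-2) grad w. *)
Definition p_flux (R : realType) (N : nat) (p : R) (w : 'rV[R]_N -> R)
    (x : 'rV[R]_N) : 'rV[R]_N :=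
  enorm (grad w x) `^ (p - 2) *: grad w x.

(* Total derivatives take arbitrary values where a limit fails to exist, so
   that "div F (x) = a" has to include the existence of the partial
   derivatives involved. *)
Definition has_divergence (R : realType) (N : nat) (F : 'rV[R]_N -> 'rV[R]_N)
    (x : 'rV[R]_N) (a : R) : Prop :=
  (forall i : 'I_N, derivable (fun y => F y ord0 i) x (basis_vec R i)) /\
  \sum_(i < N) partial i (fun y => F y ord0 i) x = a.

Definition has_p_laplacian (R : realType) (N : nat) (p : R)
    (w : 'rV[R]_N -> R) (x : 'rV[R]_N) (a : R) : Prop :=
  has_divergence (p_flux p w) x a.

Definition radial (R : realType) (N : nat) (w : 'rV[R]_N -> R) : Prop :=
  forall x y, unit_ball x -> unit_ball y -> enorm x = enorm y -> w x = w y.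

(* w(r) := w(r e_1); for radial w and 0 <= r < 1 the direction is irrelevant. *)
Definition profile (R : realType) (N : nat) (w : 'rV[R]_N -> R) (r : R) : R :=
  w (r *: \row_(i < N) (i == 0%N :> nat)%:R).

Definition constant_near_origin (R : realType) (N : nat)
    (w : 'rV[R]_N -> R) : Prop :=
  exists c : R, \forall x \near (0 : 'rV[R]_N), w x = c.

(* The functions live on the unit ball; their values outside it are
   irrelevant, every condition below being local to the open ball.
   The equations are imposed pointwise off the origin, where the functions
   are C^2.  Since u and v are C^1 and N >= 2, this is no loss: the fluxes
   and the right-hand sides are continuous on the whole ball, so a single point
   carries no additional condition, and the same equations hold in the weak
   sense across the origin. *)
Definition nonconstant_positive_radial_solution (R : realType) (N : nat)
    (p m q alpha beta : R) (u v : 'rV[R]_N -> R) : Prop :=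
  [/\ (forall x, unit_ball x -> 0 < u x /\ 0 < v x),
      radial u /\ radial v,
      (class_C 1 (@unit_ball R N) u /\ class_C 1 (@unit_ball R N) v) /\
      (class_C 2 (@punctured_unit_ball R N) u /\
       class_C 2 (@punctured_unit_ball R N) v),
      (forall x, punctured_unit_ball x ->
         has_p_laplacian p u x (v x `^ m * enorm (grad u x) `^ alpha) /\
         has_p_laplacian p v x (v x `^ beta * enorm (grad u x) `^ q)) &
      ~ constant_near_origin u /\ ~ constant_near_origin v].

Definition asymp_equiv_left1 (R : realType) (f g : R -> R) : Prop :=
  f r / g r @[r --> (1 : R)^'-] --> (1 : R).

(* Main.v *)
Require Import Defs.
From HB Require Import structures.
From mathcomp Require Import all_boot all_order all_algebra.
From mathcomp Require Import all_classical all_reals all_analysis.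
From mathcomp Require Import ring lra.
Set Implicit Arguments.
Unset Strict Implicit.
Unset Printing Implicit Defensive.
Import Order.TTheory GRing.Theory Num.Theory.
Import numFieldNormedType.Exports.
Local Open Scope classical_set_scope.
Local Open Scope ring_scope.

(** In the radial variable r = |x|, with f = u', w = v' and c = (N-1)/(p-1), the
  system reads f' = f (A - c/r), v' = v B, w' = w (C - c/r), where
    A = v^m f^(alpha-p+1) / (p-1),  B = w / v,  C = v^beta f^q w^(1-p) / (p-1).
  The three rates A, B, C satisfy a quadratic Kolmogorov system, up to relative
  terms of order 1/r, which stay bounded near r = 1.  Because that system is
  homogeneous, the quotients A/B and C/B obey, in the new time log v (whose
  derivative is B), a planar predator-prey system of Lotka-Volterra type with
  self-limitation; its interior equilibrium is
  (alpha0/beta0, gamma0/beta0).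

  Volterra's Lyapunov function V decreases along this planar flow.  The
  bounded perturbation contributes at most K (1 + V) to dV/dr, and since the
  interval of r is finite this is harmless: (1 + V) exp (- K r) is
  nonincreasing, so V converges.  As log v tends to infinity, a positive
  limit of V would make V tend to -oo; hence V -> 0 and the two quotients
  tend to the equilibrium ([lyapunov_at_left], [lotka_volterra_ratios]).

  Then (1/B)' = 1 - C/B + O(1/B), where C/B tends to gamma0/beta0 > 1.  So 1/B
  is eventually decreasing up to an integrating factor, its limit is 0
  (otherwise B, and with it log v, would be bounded), and l'Hopital's rule
  gives (1-r) B -> beta0 ([lotka_volterra_blowup_rate]).  Consequently
  (1-r) A -> alpha0 and (1-r) C -> gamma0.  The logarithms of A, B, C are
  linear combinations of log f, log v, log w, and delta <> 0 allows one to
  solve for log v and log f; this yields both the exponents and the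
  constants lambda, mu, without integrating an asymptotic relation
  ([radial_asymptotics]).

  The passage from the system in the ball to these equations rests on
  grad w (x) = W'(|x|) x/|x| for a radial w with profile W, which turns the
  p-Laplacian into G' + (N-1)/r G with G = |W'|^(p-2) W'
  ([radial_p_laplacian]).  Finally r^(N-1) G is nondecreasing and vanishes at
  the origin, so that W' is positive on all of (0,1) unless W is constant near
  the origin ([derive1_profile_gt0]). *)

(** * Monotone functions and left limits *)

Section monotone.
Context {R : realType}.
Implicit Types (f df : R -> R) (a b : R).

Lemma nonincreasing_of_derive_le0 f df a b :
  (forall x, a < x < b -> is_derive x 1 f (df x)) ->
  (forall x, a < x < b -> df x <= 0) ->
  forall x y, a < x -> x <= y -> y < b -> f y <= f x.
Proof.
move=> fdf df0 x y ax xy yb.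
have inab z : z \in `[x, y] -> a < z < b.
  rewrite in_itv/= => /andP[xz zy].
  by rewrite (lt_le_trans ax xz) (le_lt_trans zy yb).
have [z zxy E] : exists2 z, z \in `[x, y] & f y - f x = df z * (y - x).
  apply: MVT_segment => // [z zxy|].
    by apply: fdf; apply: inab; exact: subset_itv_oo_cc zxy.
  by apply: derivable_within_continuous => z /inab /fdf /@ex_derive.
by rewrite -subr_le0 E mulr_le0_ge0 ?subr_ge0// df0// inab.
Qed.

Lemma cvg_at_left_nonincreasing f a b M : a < b ->
  (forall x y, a < x -> x <= y -> y < b -> f y <= f x) ->
  (forall x, a < x < b -> M <= f x) ->
  cvg (f x @[x --> b^'-]).
Proof.
move=> ab fnincr fM.
suff: cvg (- f x @[x --> b^'-]).
  by move=> /is_cvgN; rewrite (_ : - _ = f)//; apply/funext => x /=; rewrite -[RHS]opprK.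
apply: nondecreasing_at_left_is_cvgr; near=> z.
  have az : a < z by near: z; exact: nbhs_left_gt.
  move=> x y; rewrite !in_itv/= => /andP[zx xb] /andP[zy yb] xy.
  by rewrite lerN2; apply: fnincr => //; exact: lt_trans zx.
have az : a < z by near: z; exact: nbhs_left_gt.
exists (- M) => _ /= [y + <-]; rewrite in_itv/= => /andP[zy yb].
by rewrite lerN2 fM// yb (lt_trans az zy).
Unshelve. all: by end_near. Qed.

Lemma no_upper_bound_at_left f a b M : a < b ->
  f x @[x --> b^'-] --> +oo -> ~ (forall x, a < x < b -> f x <= M).
Proof.
move=> ab foo fM.
near b^'- => x.
have : M < f x by near: x; move/cvgryPgt: foo; exact.
by apply/negP; rewrite -leNgt fM//; apply/andP; split; near: x;
  [exact: nbhs_left_gt|exact: nbhs_left_lt].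
Unshelve. all: by end_near. Qed.

Lemma near_left_of_interval (S : R -> Prop) a b : a < b ->
  (forall r, a < r < b -> S r) -> \forall r \near b^'-, S r.
Proof.
move=> ab H; near=> r; apply: H; apply/andP; split; near: r;
  [exact: nbhs_left_gt|exact: nbhs_left_lt].
Unshelve. all: by end_near. Qed.

Lemma interval_of_near_left (P : R -> Prop) a b : a < b ->
  (\forall x \near b^'-, P x) ->
  exists a', [/\ a <= a', a' < b & forall x, a' < x < b -> P x].
Proof.
move=> ab [e /= e0 eP]; exists (Num.max a (b - e)); split.
- by rewrite le_max lexx.
- by rewrite gt_max ab ltrBlDr ltrDl.
- move=> x /andP[]; rewrite gt_max => /andP[ax bex] xb; apply: eP => //=.
  by rewrite gtr0_norm ?subr_gt0// ltrBlDr addrC -ltrBlDr.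
Qed.

End monotone.

(** * A perturbed Lyapunov argument *)

Section lyapunov.
Context {R : realType}.

(** Here k plays the role of time: the dissipation D is measured per unit
  of k, and k runs to infinity, while the error K (1 + V) is measured per unit
  of r, which only has a finite distance to run.  Hence Gronwall's factor
  exp (- K r) makes V converge, and a dissipation bounded away from 0
  would exhaust V along the infinite time k. *)
Lemma lyapunov_at_left (V dV D k B : R -> R) (a b K : R) :
  a < b -> 0 <= K ->
  (forall r, a < r < b -> is_derive r 1 V (dV r)) ->
  (forall r, a < r < b -> is_derive r 1 k (B r)) ->
  (forall r, a < r < b -> 0 < B r) ->
  k r @[r --> b^'-] --> +oo ->
  (forall r, a < r < b -> 0 <= V r) ->
  (forall r, a < r < b -> 0 <= D r) ->
  (forall e : R, 0 < e -> exists2 d : R, 0 < d &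
     forall r, a < r < b -> e <= V r -> d <= D r) ->
  (forall r, a < r < b -> dV r <= - (B r * D r) + K * (1 + V r)) ->
  V r @[r --> b^'-] --> 0.
Proof.
move=> ab K0 VdV kB B0 koo V0 D0 VD dVle.
pose G r := (1 + V r) * expR (- K * r).
have GdG r : a < r < b ->
    is_derive r 1 G ((dV r - K * (1 + V r)) * expR (- K * r)).
  move=> rab; have := VdV r rab => dVr.
  rewrite /G; apply: is_derive_eq.
  rewrite /= /GRing.scale/=; ring.
have dG r : a < r < b ->
    (dV r - K * (1 + V r)) * expR (- K * r) <= - (B r * D r) * expR (- K * b).
  move=> rab; have := dVle r rab; have := B0 r rab; have := D0 r rab.
  move=> Dr Br dVr.
  have BD : 0 <= B r * D r by rewrite mulr_ge0// ltW.
  apply: (@le_trans _ _ (- (B r * D r) * expR (- K * r))).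
    by rewrite ler_wpM2r ?expR_ge0//; lra.
  rewrite !mulNr lerN2 ler_wpM2l// ler_expR lerN2 ler_wpM2l//.
  by case/andP: rab => _ /ltW.
have dG0 r : a < r < b -> (dV r - K * (1 + V r)) * expR (- K * r) <= 0.
  move=> rab; rewrite (le_trans (dG r rab))// mulNr oppr_le0 mulr_ge0 ?expR_ge0//.
  by rewrite mulr_ge0 ?D0// ltW// B0.
have G0 r : a < r < b -> 0 <= G r.
  by move=> rab; rewrite mulr_ge0 ?expR_ge0// addr_ge0// V0.
have /cvg_ex[/= g Gg] : cvg (G r @[r --> b^'-]).
  exact: (cvg_at_left_nonincreasing ab
    (nonincreasing_of_derive_le0 GdG dG0) G0).
have VL : V r @[r --> b^'-] --> g * expR (K * b) - 1.
  have -> : V = (fun r => G r * expR (K * r) - 1).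
    apply/funext => r; rewrite /G -mulrA -expRD mulNr addNr expR0 mulr1.
    by rewrite addrC addrA addNr add0r.
  apply: cvgB; last exact: cvg_cst.
  apply: cvgM => //; apply: cvg_at_left_filter.
  apply: (@cvg_comp _ _ _ ( *%R K) expR); first exact: mulrl_continuous.
  exact: continuous_expR.
set L := _ - 1 in VL.
have L0 : 0 <= L.
  by apply: (ler_cvg_to (cvg_cst 0) VL); exact: near_left_of_interval V0.
have [<-//|] := eqVneq L 0.
move=> Lneq0; have {L0 Lneq0}Lgt0 : 0 < L by rewrite lt0r Lneq0.
have [d d0 VDd] := VD (L / 2) ltac:(by rewrite divr_gt0).
have : \forall r \near b^'-, L / 2 <= V r.
  by apply: (cvgr_ge _ VL); rewrite ltr_pdivrMr// ltr_pMr// ltr1n.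
move=> /(interval_of_near_left ab)[a' [aa' a'b VL2]].
have sub r : a' < r < b -> a < r < b.
  by move=> /andP[a'r ->]; rewrite (le_lt_trans aa').
(* exp (- K r) >= exp (- K b) on the interval, hence this constant. *)
pose C := d * expR (- K * b).
have C0 : 0 < C by rewrite mulr_gt0 ?expR_gt0.
pose H r := G r + C * k r.
have HdH r : a' < r < b ->
    is_derive r 1 H ((dV r - K * (1 + V r)) * expR (- K * r) + C * B r).
  move=> /sub rab; have := GdG r rab; have := kB r rab => kr Gr.
  rewrite /H; exact: is_deriveD.
have dH r : a' < r < b ->
    (dV r - K * (1 + V r)) * expR (- K * r) + C * B r <= 0.
  move=> ra'b; have rab := sub r ra'b.
  have := dG r rab; rewrite -lerBrDr sub0r => /le_trans; apply.
  rewrite /C mulNr lerN2 mulrAC ler_wpM2r ?expR_ge0// mulrC.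
  by apply: ler_wpM2l; [exact/ltW/B0|exact/VDd/VL2].
have Hd := nonincreasing_of_derive_le0 HdH dH.
pose c := (a' + b) / 2.
have [a'c cb] : a' < c /\ c < b by rewrite !midf_lt.
exfalso; apply: (@no_upper_bound_at_left _ k c b (H c / C)) => // r /andP[cr rb].
have rab : a < r < b by apply: sub; rewrite rb (lt_trans a'c).
rewrite ler_pdivlMr// mulrC (le_trans _ (Hd c r a'c (ltW cr) rb))//.
by rewrite /H lerDr G0.
Qed.

End lyapunov.

(** * Volterra's function *)

Section volterra.
Context {R : realType}.
Implicit Types x e : R.

(** The density of Volterra's Lyapunov function at the normalized equilibrium
  1: convex on the positive half-line, with minimum 0 at 1. *)
Definition volterra (x : R) : R := x - 1 - ln x.

(** From ln x = 2 ln (sqrt x) <= 2 (sqrt x - 1).  This lower bound has linear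
  growth at infinity and a single zero, which is what boundedness
  ([dist1_le_volterra]) and convergence ([cvg1_of_volterra]) need. *)
Lemma volterra_ge_sqrt x : 0 < x -> (Num.sqrt x - 1) ^+ 2 <= volterra x.
Proof.
move=> x0; have s0 : 0 < Num.sqrt x by rewrite sqrtr_gt0.
have : ln (Num.sqrt x) <= Num.sqrt x - 1.
  have := @le_ln1Dx R (Num.sqrt x - 1); rewrite addrCA subrr addr0; apply.
  by rewrite ltrBrDl subrr.
have -> : volterra x = Num.sqrt x ^+ 2 - 1 - ln (Num.sqrt x ^+ 2).
  by rewrite sqr_sqrtr// ltW.
by rewrite lnXn// mulr2n; nra.
Qed.

Lemma volterra_ge0 x : 0 < x -> 0 <= volterra x.
Proof. by move=> /volterra_ge_sqrt; apply: le_trans; exact: sqr_ge0. Qed.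

Lemma volterra_le_sqr x : 0 < x -> x * volterra x <= (x - 1) ^+ 2.
Proof.
move=> x0; have xV0 : 0 < x^-1 by rewrite invr_gt0.
have : ln x^-1 <= x^-1 - 1.
  have := @le_ln1Dx R (x^-1 - 1); rewrite addrCA subrr addr0; apply.
  by rewrite ltrBrDl subrr.
rewrite lnV ?posrE// => lnx.
have xlnx : x * - ln x <= 1 - x.
  by rewrite (le_trans (ler_wpM2l (ltW x0) lnx))// mulrBr mulfV ?gt_eqF// mulr1.
by rewrite /volterra; nra.
Qed.

Lemma dist1_le_volterra x : 0 < x -> `|x - 1| <= 2 * (1 + volterra x).
Proof.
move=> x0; have := volterra_ge_sqrt x0; have := volterra_ge0 x0.
have := sqr_sqrtr (ltW x0); have := sqrtr_ge0 x.
set s := Num.sqrt x => s0 <- h0 sh.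
by rewrite ler_norml; apply/andP; split; nra.
Qed.

(** The factor x in [volterra_le_sqr] degenerates only where x is small, and there
  x is already far from 1; this is the origin of the minimum. *)
Lemma sqr_ge_of_volterra_ge x e : 0 < x -> e <= volterra x ->
  Num.min (4^-1) (e / 2) <= (x - 1) ^+ 2.
Proof.
move=> x0 ex; rewrite ge_min.
have := volterra_le_sqr x0; have := volterra_ge0 x0 => h0 xh.
have [x2|x2] := leP x 2^-1; apply/orP; [left|right].
  by rewrite (_ : 4^-1 = 2^-1 ^+ 2 :> R); [nra|rewrite exprVn; congr _^-1; ring].
by nra.
Qed.

Lemma cvg1_of_volterra (T : Type) (F : set_system T) {FF : Filter F} (f : T -> R) :
  (\forall t \near F, 0 < f t) ->
  volterra (f t) @[t --> F] --> 0 -> f t @[t --> F] --> (1 : R).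
Proof.
move=> f0 hf.
have sh : Num.sqrt (volterra (f t)) @[t --> F] --> (0 : R).
  rewrite -[X in _ --> X]sqrtr0.
  by apply: (@continuous_cvg _ _ _ F FF (volterra \o f) Num.sqrt 0 (@sqrt_continuous R 0)).
have sf : Num.sqrt (f t) @[t --> F] --> (1 : R).
  apply/subr_cvg0/norm_cvg0P.
  apply: (squeeze_cvgr _ (cvg_cst (0 : R)) sh); near=> t.
  have ft : 0 < f t by near: t.
  by rewrite normr_ge0/= -sqrtr_sqr ler_wsqrtr// volterra_ge_sqrt.
have ff : (fun t => Num.sqrt (f t) * Num.sqrt (f t)) t @[t --> F] --> (1 : R).
  by rewrite -[X in _ --> X]mulr1; exact: cvgM.
apply: cvg_trans ff; apply: (near_eq_cvg (F := F)).
near=> t; have ft : 0 < f t by near: t.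
by rewrite /= -expr2 sqr_sqrtr// ltW.
Unshelve. all: by end_near. Qed.

(** The factor 1 - 1/x of the derivative turns the per-capita rate d of f
  into the polynomial (f - 1) d. *)
Lemma is_derive_volterra (f : R -> R) (r d : R) : 0 < f r ->
  is_derive r 1 f (f r * d) ->
  is_derive r 1 (volterra \o f) ((f r - 1) * d).
Proof.
move=> f0 fd; have lnf := is_derive1_ln f0.
rewrite /volterra; apply: is_derive_eq.
by field; rewrite gt_eqF.
Qed.

Lemma is_derive_ratio (f g : R -> R) (r df dg P : R) : 0 < g r -> P != 0 ->
  is_derive r 1 f (f r * df) -> is_derive r 1 g (g r * dg) ->
  is_derive r 1 (fun r => f r / g r / P) (f r / g r / P * (df - dg)).
Proof.
move=> g0 P0 fd gd; have gn0 : g r != 0 by rewrite gt_eqF.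
have gV := is_deriveV gn0 gd.
apply: is_derive_eq.
rewrite /= /GRing.scale/=; field.
by rewrite P0 gn0.
Qed.

End volterra.

(** * The homogeneous quadratic system *)

Section lotka_volterra.
Context {R : realType}.
(** The functions ea, eb, ec stand for the curvature terms (N-1)/r of the radial
  p-Laplacian, of which only the boundedness matters; (P, Q) is the
  equilibrium of (A/B, C/B), and PQ1, PQ2 are its two equations. *)
Variables (A B C k ea eb ec : R -> R) (m b q be p1 P Q M a t : R).
Hypotheses (at_ : a < t) (b0 : 0 < b) (q0 : 0 < q) (p10 : 0 < p1)
  (P0 : 0 < P) (Q0 : 0 < Q)
  (PQ1 : b * P + Q = m + 1) (PQ2 : (p1 + 1) * Q = be + 1 + q * P)
  (A0 : forall r, a < r < t -> 0 < A r)
  (B0 : forall r, a < r < t -> 0 < B r)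
  (C0 : forall r, a < r < t -> 0 < C r)
  (eaM : forall r, a < r < t -> `|ea r| <= M)
  (ebM : forall r, a < r < t -> `|eb r| <= M)
  (ecM : forall r, a < r < t -> `|ec r| <= M)
  (AdA : forall r, a < r < t ->
     is_derive r 1 A (A r * (m * B r - b * A r + ea r)))
  (BdB : forall r, a < r < t -> is_derive r 1 B (B r * (C r - B r + eb r)))
  (CdC : forall r, a < r < t ->
     is_derive r 1 C (C r * (be * B r + q * A r - p1 * C r + ec r)))
  (kdk : forall r, a < r < t -> is_derive r 1 k (B r))
  (koo : k r @[r --> t^'-] --> +oo).

(** In the time k = log v the normalized quotients x = A/(B P), y = C/(B Q)
  satisfy x'/x = b P (1 - x) + Q (1 - y) and
  y'/y = q P (x - 1) - (p1 + 1) Q (y - 1), up to O(1/B).  The weights q P and Q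
  of the Lyapunov function are chosen so that the cross terms
  (x - 1)(y - 1) cancel. *)
Lemma lotka_volterra_ratios :
  A r / B r @[r --> t^'-] --> P /\ C r / B r @[r --> t^'-] --> Q.
Proof.
pose x r := A r / B r / P; pose y r := C r / B r / Q.
have x0 r : a < r < t -> 0 < x r.
  by move=> art; rewrite /x !divr_gt0 ?A0 ?B0.
have y0 r : a < r < t -> 0 < y r.
  by move=> art; rewrite /y !divr_gt0 ?C0 ?B0.
pose fx r := B r * (b * P * (1 - x r) + Q * (1 - y r)) + (ea r - eb r).
pose fy r := B r * (q * P * (x r - 1) - (p1 + 1) * Q * (y r - 1)) + (ec r - eb r).
have Bx r : a < r < t -> B r * P * x r = A r.
  by move=> art; rewrite /x; field; rewrite !gt_eqF ?B0.
have By r : a < r < t -> B r * Q * y r = C r.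
  by move=> art; rewrite /y; field; rewrite !gt_eqF ?B0.
have xdx r : a < r < t -> is_derive r 1 x (x r * fx r).
  move=> art.
  have := is_derive_ratio (B0 art) (lt0r_neq0 P0) (AdA art) (BdB art).
  congr is_derive; congr (_ * _).
  rewrite /fx -(Bx r art) -(By r art) (_ : m = b * P + Q - 1); last first.
    by rewrite PQ1 addrK.
  ring.
have ydy r : a < r < t -> is_derive r 1 y (y r * fy r).
  move=> art.
  have := is_derive_ratio (B0 art) (lt0r_neq0 Q0) (CdC art) (BdB art).
  congr is_derive; congr (_ * _).
  rewrite /fy -(Bx r art) -(By r art) (_ : be = (p1 + 1) * Q - 1 - q * P); last first.
    by rewrite PQ2; ring.
  ring.
pose V r := q * P * volterra (x r) + Q * volterra (y r).
pose dV r := q * P * ((x r - 1) * fx r) + Q * ((y r - 1) * fy r).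
pose D r := q * b * P ^+ 2 * (x r - 1) ^+ 2 + (p1 + 1) * Q ^+ 2 * (y r - 1) ^+ 2.
pose K := 4 * M * (1 + q * P + Q).
have qP : 0 < q * P by rewrite mulr_gt0.
have M0 : 0 <= M.
  have /eaM : a < (a + t) / 2 < t by rewrite !midf_lt.
  by apply: le_trans; exact: normr_ge0.
have VdV r : a < r < t -> is_derive r 1 V (dV r).
  move=> art.
  have hx := is_derive_volterra (x0 r art) (xdx r art).
  have hy := is_derive_volterra (y0 r art) (ydy r art).
  have := is_deriveD (is_deriveZ (q * P) hx) (is_deriveZ Q hy).
  by [].
have V0 r : a < r < t -> 0 <= V r.
  move=> art; rewrite addr_ge0// mulr_ge0 ?volterra_ge0 ?x0 ?y0//; exact: ltW.
have D0 r : a < r < t -> 0 <= D r.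
  by move=> _; rewrite addr_ge0// mulr_ge0 ?sqr_ge0// !mulr_ge0 ?sqr_ge0 ?ltW ?addr_gt0.
have dVle r : a < r < t -> dV r <= - (B r * D r) + K * (1 + V r).
  move=> art.
  have -> : dV r = - (B r * D r) + (q * P * ((x r - 1) * (ea r - eb r)) +
                     Q * ((y r - 1) * (ec r - eb r))).
    by rewrite /dV /D /fx /fy; ring.
  rewrite lerD2l.
  have bnd (z e : R) : 0 < z -> `|e| <= M -> (z - 1) * (e - eb r) <= 4 * M * (1 + volterra z).
    move=> z0 eM; rewrite (le_trans (ler_norm _))// normrM.
    have e2 : `|e - eb r| <= 2 * M.
      by rewrite (le_trans (ler_normB _ _))// mulr_natl mulr2n lerD// ebM.
    apply: (le_trans (ler_pM _ _ (dist1_le_volterra z0) e2)) => //.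
    by rewrite le_eqVlt; apply/orP; left; apply/eqP; ring.
  have bx := ler_wpM2l (ltW qP) (bnd _ _ (x0 r art) (eaM art)).
  have by_ := ler_wpM2l (ltW Q0) (bnd _ _ (y0 r art) (ecM art)).
  apply: (le_trans (lerD bx by_)).
  have := V0 r art => Vr.
  rewrite -subr_ge0 (_ : _ - _ = 4 * M * (1 + (q * P + Q) * V r)); last first.
    by rewrite /K /V; ring.
  rewrite !mulr_ge0//.
  by rewrite addr_ge0// mulr_ge0// ltW// addr_gt0.
have VD (e : R) : 0 < e -> exists2 d : R, 0 < d &
    forall r, a < r < t -> e <= V r -> d <= D r.
  move=> e0.
  pose dd (u v : R) := v * Num.min (4^-1) (e / 2 / u / 2).
  have dd0 u v : 0 < u -> 0 < v -> 0 < dd u v.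
    by move=> u0 v0; rewrite mulr_gt0// lt_min invr_gt0 ltr0n/= !divr_gt0.
  pose d1 := dd (q * P) (q * b * P ^+ 2); pose d2 := dd Q ((p1 + 1) * Q ^+ 2).
  have d10 : 0 < d1 by rewrite dd0// !mulr_gt0// exprn_gt0.
  have d20 : 0 < d2 by rewrite dd0// !mulr_gt0 ?exprn_gt0// addr_gt0.
  exists (Num.min d1 d2); first by rewrite lt_min d10 d20.
  move=> r art eV.
  have u0 : 0 <= q * b * P ^+ 2 * (x r - 1) ^+ 2.
    by rewrite mulr_ge0 ?sqr_ge0// !mulr_ge0 ?sqr_ge0 ?ltW.
  have v0 : 0 <= (p1 + 1) * Q ^+ 2 * (y r - 1) ^+ 2.
    by rewrite mulr_ge0 ?sqr_ge0// !mulr_ge0 ?sqr_ge0 ?ltW ?addr_gt0.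
  rewrite ge_min; apply/orP.
  have [eV1|eV1] := leP (e / 2) (q * P * volterra (x r)).
    left; apply: (le_trans _ (_ : q * b * P ^+ 2 * (x r - 1) ^+ 2 <= _)); last by rewrite lerDl.
    apply: ler_wpM2l; first by rewrite !mulr_ge0 ?sqr_ge0 ?ltW.
    apply: sqr_ge_of_volterra_ge; first exact: x0.
    by rewrite ler_pdivrMr// [leRHS]mulrC.
  right; apply: (le_trans _ (_ : (p1 + 1) * Q ^+ 2 * (y r - 1) ^+ 2 <= _)); last by rewrite lerDr.
  apply: ler_wpM2l; first by rewrite mulr_ge0 ?sqr_ge0 ?ltW ?addr_gt0.
  apply: sqr_ge_of_volterra_ge; first exact: y0.
  rewrite ler_pdivrMr// [leRHS]mulrC; move: eV; rewrite /V; lra.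
have K0 : 0 <= K by rewrite !mulr_ge0// !addr_ge0// ltW.
have Vto0 := lyapunov_at_left at_ K0 VdV kdk B0 koo V0 D0 VD dVle.
have lim1 (z : R -> R) (c : R) : 0 < c -> (forall r, a < r < t -> 0 < z r) ->
    (forall r, a < r < t -> c * volterra (z r) <= V r) -> z r @[r --> t^'-] --> (1 : R).
  move=> c0 z0 zV; apply: cvg1_of_volterra; first exact: near_left_of_interval at_ _.
  have Vc : V r / c @[r --> t^'-] --> (0 : R).
    by rewrite -[X in _ --> X](mul0r c^-1); exact: cvgMl.
  apply: (squeeze_cvgr _ (cvg_cst (0 : R)) Vc); apply: (near_left_of_interval at_) => r art.
  by rewrite volterra_ge0 ?z0//= ler_pdivlMr// mulrC zV.
split.
- have x1 : x r @[r --> t^'-] --> (1 : R).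
    apply: (lim1 _ _ qP) => // r art; rewrite lerDl mulr_ge0 ?volterra_ge0 ?y0//; exact: ltW.
  have x1P : (fun r => x r * P) r @[r --> t^'-] --> P.
    by rewrite -[X in _ --> X]mul1r; exact: cvgMl.
  apply: cvg_trans x1P; apply: near_eq_cvg; apply: (near_left_of_interval at_) => r art.
  by rewrite /x divfK ?gt_eqF.
- have y1 : y r @[r --> t^'-] --> (1 : R).
    apply: (lim1 _ _ Q0) => // r art; rewrite lerDr mulr_ge0 ?volterra_ge0 ?x0//; exact: ltW.
  have y1Q : (fun r => y r * Q) r @[r --> t^'-] --> Q.
    by rewrite -[X in _ --> X]mul1r; exact: cvgMl.
  apply: cvg_trans y1Q; apply: near_eq_cvg; apply: (near_left_of_interval at_) => r art.
  by rewrite /y divfK ?gt_eqF.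
Qed.

(** The inverse rate e = 1/B satisfies e' = 1 - C/B - eb e, so e reaches 0
  at the endpoint with slope 1 - Q. *)
Lemma lotka_volterra_blowup_rate : 1 < Q ->
  (t - r) * B r @[r --> t^'-] --> (Q - 1)^-1.
Proof.
move=> Q1; have [_ CB] := lotka_volterra_ratios.
pose e r := (B r)^-1.
have e0 r : a < r < t -> 0 < e r by move=> art; rewrite invr_gt0 B0.
pose de r := 1 - C r / B r - eb r * e r.
have ede r : a < r < t -> is_derive r 1 e (de r).
  move=> art; have Bn0 : B r != 0 by rewrite gt_eqF// B0.
  have := is_deriveV Bn0 (BdB art); congr is_derive.
  by rewrite /de /e /GRing.scale/=; field.
have [a' [aa' a't CB1]] : exists a', [/\ a <= a', a' < t &
    forall r, a' < r < t -> 1 <= C r / B r].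
  by apply: interval_of_near_left => //; apply: (cvgr_ge _ CB).
have sub r : a' < r < t -> a < r < t.
  by move=> /andP[a'r ->]; rewrite (le_lt_trans aa').
(* The exponential factor absorbs the term - eb e, whatever the sign of eb. *)
pose g r := e r * expR (- M * r).
have gdg r : a' < r < t ->
    is_derive r 1 g ((de r - M * e r) * expR (- M * r)).
  move=> /sub art; have := ede r art => er.
  rewrite /g; apply: is_derive_eq.
  by rewrite /= /GRing.scale/=; ring.
have dg0 r : a' < r < t -> (de r - M * e r) * expR (- M * r) <= 0.
  move=> ra't; have art := sub r ra't.
  rewrite mulr_le0_ge0 ?expR_ge0// /de.
  have := CB1 r ra't; have := ebM art; rewrite ler_norml => /andP[ebM' _] CBr.
  have ebM0 : 0 <= eb r + M by lra.
  have := mulr_ge0 ebM0 (ltW (e0 r art)); lra.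
have gdecr := nonincreasing_of_derive_le0 gdg dg0.
have g0 r : a' < r < t -> 0 <= g r.
  by move=> /sub art; rewrite mulr_ge0 ?expR_ge0// ltW// e0.
have /cvg_ex[/= l gl] := cvg_at_left_nonincreasing a't gdecr g0.
have el : e r @[r --> t^'-] --> l * expR (M * t).
  have -> : e = (fun r => g r * expR (M * r)).
    apply/funext => r; rewrite /g -mulrA -expRD mulNr addNr expR0 mulr1.
    by [].
  apply: cvgM => //; apply: cvg_at_left_filter.
  apply: (@cvg_comp _ _ _ ( *%R M) expR); first exact: mulrl_continuous.
  exact: continuous_expR.
set L := _ * _ in el.
have L0 : 0 <= L.
  apply: (ler_cvg_to (cvg_cst 0) el); apply: (near_left_of_interval at_) => r art.
  exact/ltW/e0.
have {L0} Lz : L = 0.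
  (* A positive limit of 1/B bounds B, hence also its primitive k. *)
  apply/eqP/negPn/negP => Ln0; have {L0 Ln0}Lgt0 : 0 < L by rewrite lt0r Ln0.
  have [a2 [aa2 a2t eL]] : exists a', [/\ a <= a', a' < t &
      forall r, a' < r < t -> L / 2 <= e r].
    apply: interval_of_near_left => //; apply: (cvgr_ge _ el).
    by rewrite ltr_pdivrMr// ltr_pMr// ltr1n.
  have sub2 r : a2 < r < t -> a < r < t.
    by move=> /andP[a2r ->]; rewrite (le_lt_trans aa2).
  pose w r := k r - 2 / L * r.
  have wdw r : a2 < r < t -> is_derive r 1 w (B r - 2 / L).
    move=> /sub2 art; have kr := kdk art.
    by rewrite /w; apply: is_derive_eq; rewrite /GRing.scale/=; ring.
  have dw r : a2 < r < t -> B r - 2 / L <= 0.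
    move=> ra2; have Br := B0 (sub2 r ra2); have := eL r ra2.
    rewrite subr_le0 /e -[2 / L]invf_div -{2}[B r]invrK lef_pV2 ?posrE ?invr_gt0//.
    by rewrite divr_gt0.
  have wd := nonincreasing_of_derive_le0 wdw dw.
  pose c := (a2 + t) / 2.
  have [a2c ct] : a2 < c /\ c < t by rewrite !midf_lt.
  apply: (@no_upper_bound_at_left _ k c t (w c + 2 / L * t)) => // r /andP[cr rt].
  rewrite -lerBlDr (le_trans _ (wd c r a2c (ltW cr) rt))//.
  by rewrite lerD2l lerN2 ler_wpM2l// ltW// divr_gt0.
rewrite Lz in el.
have etr : e r / (t - r) @[r --> t^'-] --> Q - 1.
  apply: (@lhopital_at_left R e de (fun r => t - r) (fun=> -1) a t) => //.
  - move=> r _; by apply: is_derive_eq; rewrite add0r mul1r.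
  - have tt : (fun r => t - r) r @[r --> t] --> t - t.
      by apply: cvgB; [exact: cvg_cst|exact: cvg_id].
    by rewrite subrr in tt; exact: cvg_at_left_filter tt.
  have ebe : eb r * e r @[r --> t^'-] --> (0 : R).
    have Me : M * e r @[r --> t^'-] --> (0 : R).
      by rewrite -[X in _ --> X](mulr0 M); exact: cvgMr.
    apply/norm_cvg0P; apply: (squeeze_cvgr _ (cvg_cst (0 : R)) Me).
    apply: (near_left_of_interval at_) => r art.
    by rewrite normr_ge0/= normrM (gtr0_norm (e0 r art)) ler_wpM2r ?ebM// ltW ?e0.
  rewrite (_ : Q - 1 = (1 - Q - 0) / -1); last by field.
  apply: cvgMl; apply: cvgB => //; apply: cvgB => //; exact: cvg_cst.
have Qn0 : Q - 1 != 0 by rewrite subr_eq0 gt_eqF.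
have erV : (fun r => (e r / (t - r))^-1) r @[r --> t^'-] --> (Q - 1)^-1.
  exact: cvgV.
apply: cvg_trans erV; apply: near_eq_cvg; apply: (near_left_of_interval at_) => r art.
by rewrite /e invf_div invrK.
Qed.

End lotka_volterra.

(** * Asymptotics of the radial equations *)

Lemma powRE (R : realType) (x y : R) : 0 < x -> x `^ y = expR (y * ln x).
Proof. by move=> x0; rewrite /powR gt_eqF. Qed.

Lemma is_derive_ln_comp (R : realType) (f : R -> R) (r d : R) : 0 < f r ->
  is_derive r 1 f d -> is_derive r 1 (fun x => ln (f x)) (d / f r).
Proof.
move=> f0 fd; have lnf := is_derive1_ln f0.
have := is_derive1_comp lnf fd; congr is_derive; exact: mulrC.
Qed.

Lemma ln_coefficient (R : realType) (g s b a e h : R) :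
  0 < g -> 0 < s -> 0 < b -> 0 < a ->
  ln ((g * s * b `^ s * (a * s) `^ e) `^ h) =
  h * (ln g + ln s + s * ln b + e * (ln a + ln s)).
Proof.
move=> g0 s0 b0 a0.
have gs : 0 < g * s by exact: mulr_gt0.
have as0 : 0 < a * s by exact: mulr_gt0.
have bs : 0 < b `^ s by exact: powR_gt0.
have ase : 0 < (a * s) `^ e by exact: powR_gt0.
have gsbs : 0 < g * s * b `^ s by exact: mulr_gt0.
by rewrite ln_powR (lnM gsbs ase) (lnM gs bs) (lnM g0 s0) !ln_powR (lnM a0 s0).
Qed.

Lemma coefficient_gt0 (R : realType) (g s b a e h : R) :
  0 < g -> 0 < s -> 0 < b -> 0 < a ->
  0 < (g * s * b `^ s * (a * s) `^ e) `^ h.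
Proof.
by move=> g0 s0 b0 a0; apply: powR_gt0; do ![apply: mulr_gt0|apply: powR_gt0].
Qed.

(** The equations are stated for the fluxes f^(p-1) and w^(p-1) because only
  these are differentiated in the p-Laplacian.  The theorem on quadratic
  systems applies to the rates A, B, C on (1/2,1), where the curvature terms
  n/r are bounded. *)
Lemma radial_asymptotics (R : realType) (p m q alpha beta n : R) (f v w : R -> R) :
  let delta := (p - 1 - alpha) * (p - 1 - beta) - m * q in
  let alpha0 := (1 + beta - p * (m + 1)) / delta in
  let beta0 := - ((p * (p - 1 - alpha) + q) / delta) in
  let gamma0 := 1 + beta0 in
  let lambda :=
    (gamma0 * (p - 1) * beta0 `^ (p - 1)
      * (alpha0 * (p - 1)) `^ ((p - 1 - beta) / m)) `^ (- (m / delta)) in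
  let mu :=
    (gamma0 * (p - 1) * beta0 `^ (p - 1)
      * (alpha0 * (p - 1)) `^ (q / (p - 1 - alpha)))
      `^ (- ((p - 1 - alpha) / delta)) in
  1 < p -> 0 < m -> 0 < q -> alpha < p - 1 -> delta < 0 -> 0 < alpha0 -> 0 <= n ->
  (forall r : R, 0 < r < 1 -> 0 < f r) ->
  (forall r : R, 0 < r < 1 -> 0 < v r) ->
  (forall r : R, 0 < r < 1 -> 0 < w r) ->
  (forall r : R, 0 < r < 1 -> is_derive r 1 v (w r)) ->
  (forall r : R, 0 < r < 1 -> is_derive r 1 (fun x => f x `^ (p - 1))
     (v r `^ m * f r `^ alpha - n / r * f r `^ (p - 1))) ->
  (forall r : R, 0 < r < 1 -> is_derive r 1 (fun x => w x `^ (p - 1))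
     (v r `^ beta * f r `^ q - n / r * w r `^ (p - 1))) ->
  v r @[r --> (1 : R)^'-] --> +oo ->
  asymp_equiv_left1 f (fun r => lambda / (1 - r) `^ alpha0) /\
  asymp_equiv_left1 v (fun r => mu / (1 - r) `^ beta0).
Proof.
move=> delta alpha0 beta0 gamma0 lambda mu p1 m0 q0 alp delta0 alpha00 n0.
move=> f0 v0 w0 vw fd wd voo.
pose s := p - 1; pose b := s - alpha; pose c := n / s.
have s0 : 0 < s by rewrite subr_gt0.
have b0 : 0 < b by rewrite subr_gt0.
have c0 : 0 <= c by rewrite divr_ge0// ltW.
have sn0 : s != 0 by rewrite gt_eqF.
have dn0 : delta != 0 by rewrite lt_eqF.
have nd0 : 0 < - delta by rewrite oppr_gt0.
pose k r := ln (v r); pose a r := ln (f r); pose l r := ln (w r).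
pose A r := expR (m * k r - b * a r) / s.
pose B r := expR (l r - k r).
pose C r := expR (beta * k r + q * a r - s * l r) / s.
have sub (r : R) : 2^-1 < r < 1 -> 0 < r < 1.
  by move=> /andP[r2 ->]; rewrite (lt_trans _ r2) ?invr_gt0.
have kdk (r : R) : 0 < r < 1 -> is_derive r 1 k (B r).
  move=> r01; have := is_derive_ln_comp (v0 r r01) (vw r r01).
  by congr is_derive; rewrite /B expRB !lnK ?posrE ?w0 ?v0.
have ln_flux (g : R -> R) (r e : R) : 0 < r < 1 -> (forall r : R, 0 < r < 1 -> 0 < g r) ->
    is_derive r 1 (fun x => g x `^ s) (expR e - n / r * g r `^ s) ->
    is_derive r 1 (fun x => ln (g x)) (expR (e - s * ln (g r)) / s - c / r).
  move=> r01 g0 gd; have gs0 : 0 < g r `^ s by rewrite powR_gt0 ?g0.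
  have := is_deriveZ s^-1 (is_derive_ln_comp (f := fun x => g x `^ s) gs0 gd).
  rewrite (_ : _ \*: _ = (fun x => ln (g x))); last first.
    by apply/funext => x; rewrite /= /GRing.scale/= ln_powR mulKf.
  congr is_derive; rewrite /GRing.scale/= /c expRB -powRE ?g0//.
  have [r0 _] := andP r01.
  by field; rewrite ?sn0 ?(gt_eqF gs0) ?(gt_eqF r0).
have ada (r : R) : 0 < r < 1 -> is_derive r 1 a (A r - c / r).
  move=> r01.
  have := @ln_flux f r (m * ln (v r) + alpha * ln (f r)) r01 f0.
  rewrite (expRD (m * _)) -(powRE m (v0 r r01)) -(powRE alpha (f0 r r01)) => /(_ (fd r r01)).
  by congr is_derive; rewrite /A /b; congr (expR _ / s - _); rewrite /a /k; ring.
have ldl (r : R) : 0 < r < 1 -> is_derive r 1 l (C r - c / r).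
  move=> r01.
  have := @ln_flux w r (beta * ln (v r) + q * ln (f r)) r01 w0.
  by rewrite (expRD (beta * _)) -(powRE beta (v0 r r01)) -(powRE q (f0 r r01)) => /(_ (wd r r01)).
have expd (g : R -> R) (r d K : R) : is_derive r 1 g d ->
    is_derive r 1 (fun x => expR (g x) * K) (expR (g r) * K * d).
  move=> gd; apply: is_derive_eq; rewrite /GRing.scale/=; ring.
pose ea r := b * c / r; pose eb r := - (c / r); pose ec r := (s - q) * c / r.
pose M := (b + 1 + `|s - q|) * (c * 2).
have cr (r : R) : 2^-1 < r < 1 -> 0 <= c / r <= c * 2.
  move=> /[dup]/sub/andP[r0 _] /andP[r2 _]; rewrite (divr_ge0 c0 (ltW r0))/=.
  by apply: ler_wpM2l => //; rewrite -[leRHS]invrK lef_pV2 ?posrE ?invr_gt0// ltW.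
have eM (z r : R) : `|z| <= b + 1 + `|s - q| -> 2^-1 < r < 1 -> `|z * (c / r)| <= M.
  move=> zM /cr/andP[cr0 cr2]; rewrite normrM (ger0_norm cr0).
  exact: ler_pM.
have nsq := normr_ge0 (s - q).
have eaM (r : R) : 2^-1 < r < 1 -> `|ea r| <= M.
  by move=> r2; rewrite /ea -mulrA; apply: eM => //; rewrite gtr0_norm//; lra.
have ebM (r : R) : 2^-1 < r < 1 -> `|eb r| <= M.
  by move=> r2; rewrite /eb -mulN1r; apply: eM => //; rewrite normrN1; lra.
have ecM (r : R) : 2^-1 < r < 1 -> `|ec r| <= M.
  by move=> r2; rewrite /ec -mulrA; apply: eM => //; lra.
have A0 r : 2^-1 < r < 1 -> 0 < A r by move=> _; rewrite divr_gt0 ?expR_gt0.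
have B0 r : 2^-1 < r < 1 -> 0 < B r by move=> _; rewrite expR_gt0.
have C0 r : 2^-1 < r < 1 -> 0 < C r by move=> _; rewrite divr_gt0 ?expR_gt0.
have AdA (r : R) : 2^-1 < r < 1 -> is_derive r 1 A (A r * (m * B r - b * A r + ea r)).
  move=> /sub r01; have kr := kdk r r01; have ar := ada r r01.
  have gd : is_derive r 1 (fun x => m * k x - b * a x) (m * B r - b * (A r - c / r)).
    exact: is_deriveB.
  by have := expd _ _ _ s^-1 gd; congr is_derive; rewrite -/(A r) /ea; congr (_ * _); ring.
have BdB (r : R) : 2^-1 < r < 1 -> is_derive r 1 B (B r * (C r - B r + eb r)).
  move=> /sub r01; have kr := kdk r r01; have lr := ldl r r01.
  have gd : is_derive r 1 (fun x => l x - k x) (C r - c / r - B r).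
    exact: is_deriveB.
  have := expd _ _ _ 1 gd; rewrite mulr1 (_ : (fun x => _ * 1) = B); last first.
    by apply/funext => x; rewrite mulr1.
  by congr is_derive; rewrite -/(B r) /eb; congr (_ * _); ring.
have CdC (r : R) : 2^-1 < r < 1 ->
    is_derive r 1 C (C r * (beta * B r + q * A r - s * C r + ec r)).
  move=> /sub r01; have kr := kdk r r01; have lr := ldl r r01; have ar := ada r r01.
  have gd : is_derive r 1 (fun x => beta * k x + q * a x - s * l x)
      (beta * B r + q * (A r - c / r) - s * (C r - c / r)).
    by apply: is_deriveB; exact: is_deriveD.
  by have := expd _ _ _ s^-1 gd; congr is_derive; rewrite -/(C r) /ec; congr (_ * _); ring.
have koo : k r @[r --> (1 : R)^'-] --> +oo.
  apply/cvgryPgt => y; move/cvgryPgt : voo => /(_ (expR y)).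
  move=> vy; near=> r; rewrite -[y]expRK ltr_ln ?posrE ?expR_gt0//.
    by near: r.
  by apply: (lt_trans (expR_gt0 y)); near: r.
have Ea : delta * alpha0 = 1 + beta - p * (m + 1) by rewrite mulrC divfK.
have Eb : delta * beta0 = - (p * b + q) by rewrite mulrN mulrC divfK.
(* E1, E3 and gamma0 = 1 + beta0 say that (alpha0, beta0, gamma0) / (1 - r) is an
   exact solution of the unperturbed quadratic system. *)
have E1 : b * alpha0 + 1 = m * beta0.
  apply: (mulfI dn0); rewrite mulrDr mulrCA Ea mulr1 mulrCA Eb /delta /b /s; ring.
have E3 : beta * beta0 + q * alpha0 = 1 + s * gamma0.
  apply: (mulfI dn0).
  rewrite /gamma0 !(mulrDr delta) (mulrCA delta beta) (mulrCA delta q) Ea.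
  rewrite (mulrCA delta s) (mulrDr delta) Eb !mulr1 /delta /b /s; ring.
have beta00 : 0 < beta0.
  rewrite -(pmulr_rgt0 _ nd0) mulNr Eb opprK addr_gt0// mulr_gt0//.
  by rewrite (lt_trans ltr01).
have gamma00 : 0 < gamma0 by rewrite addr_gt0.
have bn0 : beta0 != 0 by rewrite gt_eqF.
have PQ1 : b * (alpha0 / beta0) + gamma0 / beta0 = m + 1.
  apply: (mulIf bn0); rewrite (mulrDl m) mul1r -E1 /gamma0.
  by field.
have PQ2 : (s + 1) * (gamma0 / beta0) = beta + 1 + q * (alpha0 / beta0).
  apply: (mulIf bn0).
  rewrite (_ : _ * beta0 = (s + 1) * gamma0); last by field.
  transitivity (beta * beta0 + q * alpha0 + beta0); last by field.
  by rewrite E3 /gamma0; ring.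
have Q1 : 1 < gamma0 / beta0 by rewrite ltr_pdivlMr// mul1r ltrDr.
have P0 : 0 < alpha0 / beta0 by rewrite divr_gt0.
have Q0 : 0 < gamma0 / beta0 by rewrite divr_gt0.
have h1 : 2^-1 < 1 :> R by rewrite invf_lt1// ltr1n.
have [AB CB] := lotka_volterra_ratios h1 b0 q0 s0 P0 Q0 PQ1 PQ2 A0 B0 C0
  eaM ebM ecM AdA BdB CdC (fun r h => kdk r (sub r h)) koo.
have B1 := lotka_volterra_blowup_rate h1 b0 q0 s0 P0 Q0 PQ1 PQ2 A0 B0 C0
  eaM ebM ecM AdA BdB CdC (fun r h => kdk r (sub r h)) koo Q1.
have {}B1 : (1 - r) * B r @[r --> (1 : R)^'-] --> beta0.
  move: B1; rewrite (_ : (_ - 1)^-1 = beta0)//.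
  by rewrite /gamma0 mulrDl mulfV// mul1r addrK invrK.
have ln1 (X : R -> R) (x : R) : 0 < x -> X r / B r @[r --> (1 : R)^'-] --> x / beta0 ->
    ln ((1 - r) * X r) @[r --> (1 : R)^'-] --> ln x.
  move=> x0 XB; apply: (@continuous_cvg _ _ _ _ _ (fun r => (1 - r) * X r) _ x).
    exact: continuous_ln.
  have XBB : (fun r => X r / B r * ((1 - r) * B r)) r @[r --> (1 : R)^'-] --> x.
    by rewrite -[x in _ --> x](divfK bn0); exact: cvgM.
  apply: cvg_trans XBB; apply: near_eq_cvg; apply: (near_left_of_interval h1) => r r2.
  by rewrite mulrCA divfK// gt_eqF// B0.
have lA := ln1 A alpha0 alpha00 AB.
have lC := ln1 C gamma0 gamma00 CB.
have lB : ln ((1 - r) * B r) @[r --> (1 : R)^'-] --> ln beta0.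
  by apply: (@continuous_cvg _ _ _ _ _ (fun r => (1 - r) * B r)) => //; exact: continuous_ln.
pose S r := ln (1 - r) : R.
have lAE r : 2^-1 < r < 1 -> ln ((1 - r) * A r) = S r + (m * k r - b * a r) - ln s.
  move=> r2; have [_ r1] := andP r2.
  rewrite lnM ?posrE ?subr_gt0 ?A0// ln_div ?posrE ?expR_gt0// expRK; exact: addrA.
have lBE r : 2^-1 < r < 1 -> ln ((1 - r) * B r) = S r + (l r - k r).
  move=> r2; have [_ r1] := andP r2.
  by rewrite lnM ?posrE ?subr_gt0 ?B0// expRK.
have lCE r : 2^-1 < r < 1 ->
    ln ((1 - r) * C r) = S r + (beta * k r + q * a r - s * l r) - ln s.
  move=> r2; have [_ r1] := andP r2.
  rewrite lnM ?posrE ?subr_gt0 ?C0// ln_div ?posrE ?expR_gt0// expRK; exact: addrA.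
have bnz : b != 0 by rewrite gt_eqF.
have mn0 : m != 0 by rewrite gt_eqF.
have lnmu : ln mu = - delta^-1 * (q * ln alpha0 + b * ln gamma0 + b * s * ln beta0
    + (q + b) * ln s).
  rewrite (ln_coefficient _ _ gamma00 s0 beta00 alpha00) -/s -/b.
  by field; rewrite dn0.
have lnlambda : ln lambda = b^-1 * (m * ln mu - ln alpha0 - ln s).
  rewrite lnmu (ln_coefficient _ _ gamma00 s0 beta00 alpha00) -/s.
  move: (ln _) (ln _) (ln _) (ln _) => x y z t.
  have -> : q = (b * (s - beta) - delta) / m by rewrite /delta -/s -/b; field.
  by field; rewrite dn0 bnz mn0.
(* q ln A + b ln C + b s ln B equals - delta ln v up to a constant: the terms in
   ln f and ln w cancel. *)
have kE r : 2^-1 < r < 1 -> k r + beta0 * S r = - delta^-1 *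
    (q * ln ((1 - r) * A r) + b * ln ((1 - r) * C r) +
     b * s * ln ((1 - r) * B r) + (q + b) * ln s).
  move=> r2; rewrite lAE// lBE// lCE//; apply: (mulfI dn0).
  rewrite mulrDr (mulrA delta beta0) Eb mulrA mulrN mulfV// mulN1r.
  by rewrite /delta -/s -/b (_ : p = s + 1); [ring|rewrite /s subrK].
have aE r : 2^-1 < r < 1 -> a r + alpha0 * S r = b^-1 *
    (m * (k r + beta0 * S r) - ln ((1 - r) * A r) - ln s).
  move=> r2; rewrite lAE//; apply: (mulfI bnz); rewrite mulVKf// mulrDr.
  by rewrite (mulrDr m) (mulrA m) -E1; ring.
have klim : k r + beta0 * S r @[r --> (1 : R)^'-] --> ln mu.
  have : (fun r => - delta^-1 *
    (q * ln ((1 - r) * A r) + b * ln ((1 - r) * C r) +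
     b * s * ln ((1 - r) * B r) + (q + b) * ln s)) r @[r --> (1 : R)^'-] --> ln mu.
    rewrite lnmu; apply: cvgMr; apply: cvgD; last exact: cvg_cst.
    by apply: cvgD; [apply: cvgD|]; exact: cvgMr.
  move=> H; apply: cvg_trans H; apply: near_eq_cvg; apply: (near_left_of_interval h1) => r r2.
  by rewrite kE.
have alim : a r + alpha0 * S r @[r --> (1 : R)^'-] --> ln lambda.
  have : (fun r => b^-1 * (m * (k r + beta0 * S r) - ln ((1 - r) * A r) - ln s)) r
      @[r --> (1 : R)^'-] --> ln lambda.
    rewrite lnlambda; apply: cvgMr; apply: cvgB; last exact: cvg_cst.
    by apply: cvgB => //; exact: cvgMr.
  move=> H; apply: cvg_trans H; apply: near_eq_cvg; apply: (near_left_of_interval h1) => r r2.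
  by rewrite aE.
have asymp (g : R -> R) (x y : R) : (forall r : R, 0 < r < 1 -> 0 < g r) -> 0 < x ->
    ln (g r) + y * S r @[r --> (1 : R)^'-] --> ln x ->
    asymp_equiv_left1 g (fun r => x / (1 - r) `^ y).
  move=> g0 x0 glim; rewrite /asymp_equiv_left1.
  have : (fun r => expR (ln (g r) + y * S r - ln x)) r @[r --> (1 : R)^'-] --> (1 : R).
    rewrite -[X in _ --> X]expR0 -(subrr (ln x)).
    apply: (@continuous_cvg _ _ _ _ _ (fun r => ln (g r) + y * S r - ln x) expR).
      exact: continuous_expR.
    by apply: cvgB => //; exact: cvg_cst.
  move=> H; apply: cvg_trans H; apply: near_eq_cvg; apply: (near_left_of_interval h1) => r r2.
  have r01 := sub r r2; have [_ r1] := andP r01.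
  rewrite expRB expRD !lnK ?posrE ?g0// powRE ?subr_gt0//.
  by rewrite invf_div mulrA.
split.
- exact: (asymp f lambda alpha0 f0 (coefficient_gt0 _ _ gamma00 s0 beta00 alpha00) alim).
- exact: (asymp v mu beta0 v0 (coefficient_gt0 _ _ gamma00 s0 beta00 alpha00) klim).
Unshelve. all: by end_near. Qed.

(** * Radial functions *)

Lemma is_derive_lineP (R : realType) (V : normedModType R) (w : V -> R) (x v : V) (d : R) :
  is_derive (0 : R) 1 (fun h : R => w (h *: v + x)) d <-> is_derive x v w d.
Proof.
have E : 'D_1 (fun h : R => w (h *: v + x)) 0 = 'D_v w x.
  rewrite /derive; set g1 := fun h => h^-1 *: _; set g2 := fun h => h^-1 *: _.
  suff -> : g1 = g2 by [].
  by rewrite funeqE /g1 /g2 => h /=; rewrite addr0 scale0r add0r [_%:A]mulr1.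
split=> -[dw <-].
  exact: (DeriveDef ((derivable1P w x v).2 dw) (esym E)).
exact: (DeriveDef ((derivable1P w x v).1 dw) E).
Qed.

Section euclid.
Context {R : realType} {N : nat}.
Implicit Types (x y : 'rV[R]_N) (i : 'I_N).

Definition e1 : 'rV[R]_N := \row_(i < N) (i == 0%N :> nat)%:R.

Lemma enorm_sqr x : enorm x ^+ 2 = \sum_(i < N) x ord0 i ^+ 2.
Proof. by rewrite sqr_sqrtr// sumr_ge0// => i _; exact: sqr_ge0. Qed.

Lemma enorm_ge0 x : 0 <= enorm x.
Proof. exact: sqrtr_ge0. Qed.

Lemma enormZ (c : R) x : enorm (c *: x) = `|c| * enorm x.
Proof.
rewrite /enorm -sqrtr_sqr -sqrtrM ?sqr_ge0// mulr_sumr.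
by congr Num.sqrt; apply: eq_bigr => i _; rewrite mxE exprMn.
Qed.

Lemma enorm_gt0 x : x != 0 -> 0 < enorm x.
Proof.
move=> x0; rewrite lt0r enorm_ge0 andbT; apply: contra x0 => /eqP ex.
apply/eqP/rowP => i; rewrite mxE; apply/eqP; rewrite -sqrf_eq0.
have := enorm_sqr x; rewrite ex expr0n/= => /esym/eqP.
rewrite psumr_eq0 => [/allP/(_ i)|j _]; last exact: sqr_ge0.
by apply; rewrite mem_index_enum.
Qed.

Lemma basis_vec0 (i0 : 'I_N) : i0 = 0%N :> nat -> basis_vec R i0 = e1.
Proof.
move=> i00; apply/rowP => i; rewrite !mxE eqxx/=; congr (_%:R).
by rewrite -val_eqE/= i00.
Qed.

Lemma enorm_basis i : enorm (basis_vec R i) = 1.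
Proof.
rewrite /enorm (bigD1 i)//= big1 ?addr0 => [|j ji].
  by rewrite mxE !eqxx expr1n sqrtr1.
by rewrite mxE eqxx (negbTE ji)/= expr0n.
Qed.

Lemma enorm_line x i (h : R) :
  enorm (h *: basis_vec R i + x) = Num.sqrt (enorm x ^+ 2 + (h * (2 * x ord0 i) + h ^+ 2)).
Proof.
rewrite enorm_sqr /enorm; congr Num.sqrt.
rewrite (bigD1 i)//= [in RHS](bigD1 i)//= !mxE !eqxx/= mulr1.
rewrite [X in _ + X](_ : _ = \sum_(j < N | j != i) x ord0 j ^+ 2); first by ring.
by apply: eq_bigr => j ji; rewrite !mxE eqxx (negbTE ji)/= mulr0 add0r.
Qed.

Lemma is_derive_enorm_line x i : x != 0 ->
  is_derive (0 : R) 1 (fun h : R => enorm (h *: basis_vec R i + x)) (x ord0 i / enorm x).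
Proof.
move=> x0; have ex := enorm_gt0 x0.
rewrite (_ : (fun h => _) = Num.sqrt \o
    (fun h : R => enorm x ^+ 2 + (h * (2 * x ord0 i) + h ^+ 2))); last first.
  by apply/funext => h; rewrite enorm_line.
have E0 : enorm x ^+ 2 + ((0 : R) * (2 * x ord0 i) + (0 : R) ^+ 2) = enorm x ^+ 2.
  by rewrite mul0r expr0n !addr0.
have e20 : 0 < enorm x ^+ 2 + ((0 : R) * (2 * x ord0 i) + (0 : R) ^+ 2).
  by rewrite E0 exprn_gt0.
have sd := is_derive1_sqrt e20.
have qd : is_derive (0 : R) 1
    (fun h : R => enorm x ^+ 2 + (h * (2 * x ord0 i) + h ^+ 2)) (2 * x ord0 i).
  apply: is_derive_eq; rewrite /GRing.scale/=; ring.
have := is_derive1_comp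
  (g := fun h : R => enorm x ^+ 2 + (h * (2 * x ord0 i) + h ^+ 2)) sd qd.
congr is_derive.
rewrite E0 sqrtr_sqr gtr0_norm//; field; by rewrite gt_eqF.
Qed.

Lemma near_line_ball x i : x != 0 -> unit_ball x ->
  \forall h \near (0 : R), unit_ball (h *: basis_vec R i + x) /\ h *: basis_vec R i + x != 0.
Proof.
move=> x0 bx; have ex := enorm_gt0 x0.
have /@ex_derive/derivable1_diffP/differentiable_continuous cn :=
  is_derive_enorm_line i x0.
have {}cn : (fun h : R => enorm (h *: basis_vec R i + x)) h @[h --> (0 : R)] --> enorm x.
  rewrite -[X in _ --> enorm X]add0r -(scale0r (basis_vec R i)); exact: cn.
near=> h; split.
  by rewrite /unit_ball/=; near: h; exact: (cvgr_lt _ cn).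
have : 0 < enorm (h *: basis_vec R i + x) by near: h; exact: (cvgr_gt _ cn).
apply: contraTneq => ->; rewrite /enorm big1 ?sqrtr0 ?ltxx// => j _.
by rewrite mxE expr0n.
Unshelve. all: by end_near. Qed.

End euclid.
Arguments e1 {R N}.

Section radial.
Context {R : realType} {N : nat} (i0 : 'I_N) (i00 : i0 = 0%N :> nat).
Implicit Types (w : 'rV[R]_N -> R) (r : R).

Lemma enorm_e1 r : enorm (r *: e1 : 'rV[R]_N) = `|r|.
Proof. by rewrite enormZ -(basis_vec0 i00) enorm_basis mulr1. Qed.

Lemma radialE w x : radial w -> unit_ball x -> w x = profile w (enorm x).
Proof.
move=> rw bx; apply: rw => //; rewrite /unit_ball/= enorm_e1 ger0_norm ?enorm_ge0//.
Qed.

(** An equality of limits, valid whether or not they exist. *)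
Lemma derive1_profile w r : (profile w)^`()%classic r = partial i0 w (r *: e1).
Proof.
rewrite derive1E /partial /derive.
set g1 := fun h => h^-1 *: _; set g2 := fun h => h^-1 *: _.
suff -> : g1 = g2 by [].
rewrite funeqE /g1 /g2 => h /=.
by rewrite (basis_vec0 i00) /profile scalerDl [h *: 1]mulr1.
Qed.

Lemma is_derive_profile w r : class_C 1 (@unit_ball R N) w -> `|r| < 1 ->
  is_derive r 1 (profile w) ((profile w)^`()%classic r).
Proof.
move=> [_ /(_ i0)[dw _]] r1; rewrite derive1E; apply/derivableP.
have : derivable w (r *: e1) (basis_vec R i0).
  by apply: dw; rewrite /unit_ball/= enorm_e1.
rewrite /derivable; set g1 := fun h => h^-1 *: _; set g2 := fun h => h^-1 *: _.
suff -> : g1 = g2 by [].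
rewrite funeqE /g1 /g2 => h /=.
by rewrite (basis_vec0 i00) /profile scalerDl [h *: 1]mulr1.
Qed.

Lemma is_derive_radial w x i : class_C 1 (@unit_ball R N) w -> radial w ->
  punctured_unit_ball x ->
  is_derive x (basis_vec R i) w ((profile w)^`()%classic (enorm x) * (x ord0 i / enorm x)).
Proof.
move=> cw rw [bx x0]; apply/is_derive_lineP.
have nd := is_derive_enorm_line i x0.
have : is_derive (enorm (0 *: basis_vec R i + x)) 1 (profile w)
    ((profile w)^`()%classic (enorm x)).
  by rewrite scale0r add0r; apply: is_derive_profile => //; rewrite ger0_norm ?enorm_ge0.
move=> wd; have := is_derive1_comp
  (g := fun h : R => enorm (h *: basis_vec R i + x)) wd nd.
apply: near_eq_is_derive.
near=> h; rewrite /= -radialE//.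
suff [] : unit_ball (h *: basis_vec R i + x) /\ h *: basis_vec R i + x != 0 by [].
by near: h; exact: near_line_ball.
Unshelve. all: by end_near. Qed.

Lemma grad_radial w x : class_C 1 (@unit_ball R N) w -> radial w ->
  punctured_unit_ball x ->
  grad w x = ((profile w)^`()%classic (enorm x) / enorm x) *: x.
Proof.
move=> cw rw px; apply/rowP => i; rewrite !mxE /partial.
by rewrite (derive_val (is_derive := is_derive_radial i cw rw px)) mulrAC mulrA.
Qed.

Lemma enorm_grad_radial w x : class_C 1 (@unit_ball R N) w -> radial w ->
  punctured_unit_ball x ->
  enorm (grad w x) = `|(profile w)^`()%classic (enorm x)|.
Proof.
move=> cw rw px; rewrite grad_radial// enormZ normrM normfV.
by case: px => _ /enorm_gt0 ex; rewrite (gtr0_norm ex) divfK// gt_eqF.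
Qed.

Definition flux (p s : R) : R := `|s| `^ (p - 2) * s.

Lemma p_flux_radial p w x i : class_C 1 (@unit_ball R N) w -> radial w ->
  punctured_unit_ball x ->
  p_flux p w x ord0 i = flux p ((profile w)^`()%classic (enorm x)) * (x ord0 i / enorm x).
Proof.
move=> cw rw px; rewrite /p_flux enorm_grad_radial// grad_radial// !mxE /flux.
by rewrite mulrA -mulrA [in RHS]mulrAC !mulrA.
Qed.

End radial.

Section plaplace.
Context {R : realType} {N : nat} (i0 : 'I_N) (i00 : i0 = 0%N :> nat).
Implicit Types (w : 'rV[R]_N -> R) (r : R).

Lemma e1_neq0 r : 0 < r -> r *: e1 != 0 :> 'rV[R]_N.
Proof.
move=> r0; apply: contraTneq (r0) => re; rewrite -leNgt.
have := enorm_e1 i00 r; rewrite re -(scale0r (0 : 'rV[R]_N)) enormZ normr0 mul0r.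
by rewrite gtr0_norm// => <-.
Qed.

(** At the point r e1 the partial derivative of the first flux component along
  the axis is G', with G = |W'|^(p-2) W'.  Each of the N - 1 transversal ones is G/r:
  along r e1 + h e_i the distance to the origin is stationary at h = 0, so only
  the factor x_i/|x| = h/|x| varies to first order. *)
Lemma radial_p_laplacian p w r a : class_C 1 (@unit_ball R N) w -> radial w ->
  0 < r < 1 -> has_p_laplacian p w (r *: e1) a ->
  is_derive r 1 (fun s => flux p ((profile w)^`()%classic s))
    (a - N.-1%:R / r * flux p ((profile w)^`()%classic r)).
Proof.
move=> cw rw /andP[r0 r1] [dF sF].
set G := fun s => flux p ((profile w)^`()%classic s).
pose F (i : 'I_N) (y : 'rV[R]_N) := p_flux p w y ord0 i.
have re : enorm (r *: e1 : 'rV[R]_N) = r by rewrite (enorm_e1 i00) gtr0_norm.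
have rn0 : (r *: e1 : 'rV[R]_N) != 0 by exact: e1_neq0.
have rb : unit_ball (r *: e1 : 'rV[R]_N) by rewrite /unit_ball/= re.
pose rho (i : 'I_N) (h : R) := enorm (h *: basis_vec R i + r *: e1).
have nearF (i : 'I_N) : \forall h \near (0 : R), F i (h *: basis_vec R i + r *: e1) =
    G (rho i h) * ((h *: basis_vec R i + r *: e1) ord0 i / rho i h).
  by near=> h; apply: (p_flux_radial i00) => //; near: h; exact: near_line_ball.
have coord (i : 'I_N) (h : R) : (h *: basis_vec R i + r *: e1 : 'rV[R]_N) ord0 i = h + r *+ (i == i0).
  rewrite -(basis_vec0 i00) !mxE !eqxx/= mulr1; case: (i == i0) => /=.
    by rewrite mulr1.
  by rewrite mulr0.
have Gd : is_derive r 1 G (partial i0 (F i0) (r *: e1)).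
  have := derivableP (dF i0) => /is_derive_lineP.
  move=> /(@near_eq_is_derive _ _ _ _ (fun h => G (h + r)) _ _ _) H.
  have {}H : is_derive (0 : R) 1 (fun h => G (h + r)) (partial i0 (F i0) (r *: e1)).
    apply: H; near=> h.
    have hr0 : 0 < h + r.
      rewrite -ltrBlDr sub0r; near: h; apply: lt_nbhsr; by rewrite oppr_lt0.
    have Fh : F i0 (h *: basis_vec R i0 + r *: e1) =
        G (rho i0 h) * ((h *: basis_vec R i0 + r *: e1) ord0 i0 / rho i0 h).
      by near: h; exact: nearF.
    rewrite -/(F i0 _) Fh coord eqxx /rho.
    rewrite (basis_vec0 i00) -scalerDl (enorm_e1 i00) gtr0_norm// mulr1n mulfV ?mulr1//.
    by rewrite gt_eqF.
  apply/is_derive_lineP; rewrite (_ : (fun h => _) = fun h => G (h + r))//.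
  by apply/funext => h; rewrite [h *: 1]mulr1.
have Fi (i : 'I_N) : i != i0 -> partial i (F i) (r *: e1) = G r / r.
  move=> ii0.
  have rd : is_derive (0 : R) 1 (rho i) 0.
    have := is_derive_enorm_line i rn0; congr is_derive.
    by have := coord i 0; rewrite scale0r !add0r (negbTE ii0) mulr0n => ->; rewrite mul0r.
  have rho0 : rho i 0 = r by rewrite /rho scale0r add0r.
  have GR : is_derive (0 : R) 1 (fun h => G (rho i h)) 0.
    have Gd' : is_derive (rho i 0) 1 G (partial i0 (F i0) (r *: e1)) by rewrite rho0.
    by have := is_derive1_comp (g := rho i) Gd' rd; rewrite mulr0.
  have rV : is_derive (0 : R) 1 (fun h => (rho i h)^-1) 0.
    have rhon0 : rho i 0 != 0 by rewrite rho0 gt_eqF.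
    by have := is_deriveV rhon0 rd; rewrite scaler0.
  have hr : is_derive (0 : R) 1 (fun h => h * (rho i h)^-1) r^-1.
    apply: is_derive_eq; rewrite /GRing.scale/= rho0; ring.
  have Gh : is_derive (0 : R) 1 (fun h => G (rho i h) * (h * (rho i h)^-1)) (G r / r).
    by apply: is_derive_eq; rewrite /GRing.scale/= rho0; ring.
  apply: derive_val; apply/is_derive_lineP; apply: near_eq_is_derive Gh.
  near=> h; have Fh : F i (h *: basis_vec R i + r *: e1) =
      G (rho i h) * ((h *: basis_vec R i + r *: e1) ord0 i / rho i h).
    by near: h; exact: nearF.
  by rewrite Fh coord (negbTE ii0) mulr0n addr0.
move: sF; rewrite (bigD1 i0)//= (eq_bigr (fun=> G r / r)); last first.
  by move=> i ii0; exact: Fi.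
rewrite sumr_const => sF; have := Gd; congr is_derive.
rewrite -sF (_ : #|_| = N.-1); last first.
  by rewrite -[in RHS](card_ord N) -(cardC1 i0); apply: eq_card.
rewrite -/(G r) -/(F i0) -mulr_natl; ring.
Unshelve. all: by end_near. Qed.

End plaplace.

(** * Strict monotonicity of the profile *)

Section positivity.
Context {R : realType} {N : nat} (i0 : 'I_N) (i00 : i0 = 0%N :> nat).
Implicit Types (w : 'rV[R]_N -> R) (r : R).

Lemma norm_flux (p s : R) : 1 < p -> `|flux p s| = `|s| `^ (p - 1).
Proof.
move=> p1; have p10 : 0 < p - 1 by rewrite subr_gt0.
rewrite /flux normrM ger0_norm ?powR_ge0// mulrC -(mulr_powRB1 (normr_ge0 s) p10).
by rewrite -addrA -opprD.
Qed.

Lemma flux_gt0 (p s : R) : 0 < s -> 0 < flux p s.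
Proof. by move=> s0; rewrite mulr_gt0// powR_gt0// normr_gt0 gt_eqF. Qed.

Lemma flux_pos (p s : R) : 1 < p -> 0 < s -> flux p s = s `^ (p - 1).
Proof.
by move=> p1 s0; rewrite -(gtr0_norm (flux_gt0 p s0)) norm_flux// gtr0_norm.
Qed.

Lemma flux_eq0 (p s : R) : 1 < p -> flux p s = 0 -> s = 0.
Proof.
move=> p1 /eqP; rewrite -normr_eq0 norm_flux// powR_eq0 normr_eq0.
by move=> /andP[/eqP].
Qed.

Lemma near_enorm_lt (e : R) : 0 < e -> \forall x \near (0 : 'rV[R]_N), enorm x < e.
Proof.
move=> e0.
have sum_cont : continuous (fun x : 'rV[R]_N => \sum_(i < N) x ord0 i ^+ 2).
  apply: continuous_big => [|i _ x]; first exact: add_continuous.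
  apply: (@continuous_comp _ _ _ (fun x : 'rV[R]_N => x ord0 i) (fun t => t ^+ 2)).
    exact: coord_continuous.
  exact: exprn_continuous.
have := sum_cont 0; rewrite /continuous_at.
rewrite big1; last by move=> i _; rewrite mxE expr0n.
move=> /(cvgr_lt _)/(_ (e ^+ 2)); rewrite exprn_gt0// => /(_ isT).
apply: filterS => x xe.
by rewrite -(@ltr_pXn2r _ 2) ?nnegrE ?enorm_ge0 ?(ltW e0)// enorm_sqr.
Qed.

(** The function H = r^(N-1) |W'|^(p-2) W' is nondecreasing because the right-hand
  side is nonnegative, and H -> 0 at the origin because W' is bounded there
  and N >= 2.  If W' were nonpositive at some r0, then H, hence W', would vanish
  on (0,r0). *)
Lemma derive1_profile_gt0 p w (a : R -> R) : (1 < N)%N -> 1 < p ->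
  class_C 1 (@unit_ball R N) w -> radial w -> ~ constant_near_origin w ->
  (forall r : R, 0 < r < 1 -> 0 <= a r) ->
  (forall r : R, 0 < r < 1 -> has_p_laplacian p w (r *: e1) (a r)) ->
  forall r : R, 0 < r < 1 -> 0 < (profile w)^`()%classic r.
Proof.
move=> N1 p1 cw rw nc a0 wa; set W' := (profile w)^`()%classic.
have [n Nn] : exists n, N.-1 = n.+1 by case: (N) N1 => [|[|n]]// _; exists n.
pose H r := r ^+ n.+1 * flux p (W' r).
have HdH r : 0 < r < 1 -> is_derive r 1 H (r ^+ n.+1 * a r).
  move=> r01; have rn0 : r != 0 by case/andP: r01 => r0 _; rewrite gt_eqF.
  have := radial_p_laplacian i00 cw rw r01 (wa r r01); rewrite Nn -/W' => Gd.
  have Xd : is_derive r 1 (fun s : R => s ^+ n.+1) (n.+1%:R * r ^+ n).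
    have := is_deriveX n.+1 (is_derive_id r (1 : R)).
    by rewrite exprfctE; congr is_derive; rewrite /GRing.scale/= mulr1.
  have := is_deriveM Xd Gd; congr is_derive.
  by rewrite /GRing.scale/= exprS; field.
have Hincr x y : 0 < x -> x <= y -> y < 1 -> H x <= H y.
  have NHd r : 0 < r < 1 -> is_derive r 1 (fun s => - H s) (- (r ^+ n.+1 * a r)).
    by move=> r01; have := HdH r r01 => Hr; exact: is_deriveN.
  move=> x0 xy y1; rewrite -lerN2.
  apply: (nonincreasing_of_derive_le0 NHd _ x0 xy y1) => r /[dup]/a0 ar /andP[r0 _].
  by rewrite oppr_le0 mulr_ge0// exprn_ge0// ltW.
have Wbnd : \forall r \near (0 : R)^'+, `|W' r| <= `|W' 0| + 1.
  have cW : W' r @[r --> (0 : R)] --> W' 0.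
    have -> : W' = partial i0 w \o (fun r => r *: e1).
      by apply/funext => r; rewrite /W' (derive1_profile i00).
    apply: continuous_comp; first exact: scalel_continuous.
    have [_ /(_ i0)[_ /=]] := cw; apply; rewrite inE/= /unit_ball/=.
    by rewrite (enorm_e1 i00) normr0.
  have cWr := cvg_at_right_filter cW.
  by apply: (cvgr_le _ (cvg_norm cWr)); rewrite ltrDl.
have H0 : H r @[r --> (0 : R)^'+] --> (0 : R).
  apply/norm_cvg0P.
  pose K := (`|W' 0| + 1) `^ (p - 1).
  have Kr : (fun r => r ^+ n.+1 * K) r @[r --> (0 : R)^'+] --> (0 : R).
    have z : (0 : R) ^+ n.+1 * K = 0 by rewrite expr0n mul0r.
    rewrite -[X in _ --> X]z; apply: cvg_at_right_filter.
    by apply: cvgMl; exact: exprn_continuous.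
  apply: (squeeze_cvgr _ (cvg_cst (0 : R)) Kr); near=> r.
  have r0 : 0 < r by near: r; exact: nbhs_right_gt.
  rewrite normr_ge0/= normrM ger0_norm ?exprn_ge0 ?(ltW r0)// norm_flux//.
  rewrite ler_wpM2l ?exprn_ge0 ?(ltW r0)// ge0_ler_powR ?nnegrE//.
  - by rewrite subr_ge0 ltW.
  - by near: r.
have Hge0 r : 0 < r < 1 -> 0 <= H r.
  move=> /andP[r0 r1]; apply: (ler_cvg_to H0 (cvg_cst (H r))).
  near=> s; have s0 : 0 < s by near: s; exact: nbhs_right_gt.
  by apply: Hincr => //; near: s; exact: nbhs_right_le.
move=> r0 r01; have [r0gt0 r0lt1] := andP r01.
rewrite ltNge; apply/negP => W'r0; apply: nc.
have Hr0 : H r0 <= 0.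
  rewrite mulr_ge0_le0 ?exprn_ge0 ?(ltW r0gt0)//.
  by rewrite /flux mulr_ge0_le0 ?powR_ge0.
have W'0 s : 0 < s < r0 -> W' s = 0.
  move=> /andP[s0 sr0]; have s1 : s < 1 := lt_trans sr0 r0lt1.
  apply: (flux_eq0 p1); apply/eqP.
  have : H s == 0.
    by rewrite eq_le Hge0 ?s0// andbT (le_trans (Hincr _ _ s0 (ltW sr0) r0lt1)).
  by rewrite mulf_eq0 expf_eq0/= (gt_eqF s0).
exists (profile w 0); near=> x.
have xr0 : enorm x < r0 by near: x; exact: near_enorm_lt.
have x1 : enorm x < 1 := lt_trans xr0 r0lt1.
rewrite (radialE i00 rw x1); apply/eqP; rewrite -subr_eq0; apply/eqP.
have dW (s : R) : 0 <= s < 1 -> is_derive s 1 (profile w) (W' s).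
  by move=> /andP[s0 s1]; apply: (is_derive_profile i00) => //; rewrite ger0_norm.
have [ex0|exn0] := eqVneq (enorm x) 0; first by rewrite ex0 subrr.
have ex : 0 < enorm x by rewrite lt0r exn0 enorm_ge0.
have [||c] := @MVT _ (profile w) W' 0 (enorm x) ex.
- move=> s; rewrite in_itv/= => /andP[s0 sx]; apply: dW.
  by rewrite (ltW s0) (lt_trans sx).
- apply: derivable_within_continuous => s; rewrite in_itv/= => /andP[s0 sx].
  by apply: (@ex_derive _ _ _ _ _ _ _ (dW s _)); rewrite s0 (le_lt_trans sx).
by rewrite in_itv/= => /andP[c0 cx] ->; rewrite W'0 ?mul0r// c0 (lt_trans cx).
Unshelve. all: by end_near. Qed.

End positivity.

(** * The boundary behaviour *)

Lemma is_derive_flux_pow (R : realType) (p : R) (f : R -> R) (r d : R) : 1 < p ->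
  0 < r < 1 -> (forall s : R, 0 < s < 1 -> 0 < f s) ->
  is_derive r 1 (fun s => flux p (f s)) d ->
  is_derive r 1 (fun s => f s `^ (p - 1)) d.
Proof.
move=> p1 r01 f0; apply: near_eq_is_derive.
have : \forall s \near r, s \in `]0, 1[ by apply: near_in_itvoo; rewrite in_itv.
by apply: filterS => s; rewrite in_itv => s01; rewrite flux_pos// f0.
Qed.

Theorem theorem1p3 (R : realType) (N : nat) (p m q alpha beta : R)
    (u v : 'rV[R]_N -> R) :
  let delta := (p - 1 - alpha) * (p - 1 - beta) - m * q in
  let alpha0 := (1 + beta - p * (m + 1)) / delta in
  let beta0 := - ((p * (p - 1 - alpha) + q) / delta) in
  let gamma0 := 1 + beta0 in
  let lambda :=
    (gamma0 * (p - 1) * beta0 `^ (p - 1)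
      * (alpha0 * (p - 1)) `^ ((p - 1 - beta) / m)) `^ (- (m / delta)) in
  let mu :=
    (gamma0 * (p - 1) * beta0 `^ (p - 1)
      * (alpha0 * (p - 1)) `^ (q / (p - 1 - alpha)))
      `^ (- ((p - 1 - alpha) / delta)) in
  (2 <= N)%N -> 1 < p -> 0 < m -> 0 < q ->
  0 <= alpha -> alpha < p - 1 -> 0 <= beta -> beta <= m ->
  delta < 0 -> 0 < alpha0 ->
  nonconstant_positive_radial_solution p m q alpha beta u v ->
  profile v r @[r --> (1 : R)^'-] --> +oo ->
  asymp_equiv_left1 (profile u)^`()%classic (fun r => lambda / (1 - r) `^ alpha0) /\
  asymp_equiv_left1 (profile v) (fun r => mu / (1 - r) `^ beta0).
Proof.
move=> delta alpha0 beta0 gamma0 lambda mu N2 p1 m0 q0 _ alp _ _ delta0 alpha00.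
move=> [pos [ru rv] [[cu cv] _] eqs [ncu ncv]] voo.
have N0 : (0 < N)%N by exact: ltnW.
pose i0 := Ordinal N0.
have i00 : i0 = 0%N :> nat by [].
pose f := (profile u)^`()%classic; pose w := (profile v)^`()%classic.
have axis (r : R) : 0 < r < 1 ->
    enorm (r *: e1 : 'rV[R]_N) = r /\ punctured_unit_ball (r *: e1 : 'rV[R]_N).
  move=> /andP[r0 r1]; have re := enorm_e1 i00 r; rewrite gtr0_norm// in re.
  by split=> //; split; [rewrite re|exact: (e1_neq0 i00)].
pose au r := profile v r `^ m * `|f r| `^ alpha.
pose av r := profile v r `^ beta * `|f r| `^ q.
have lap (r : R) : 0 < r < 1 -> has_p_laplacian p u (r *: e1) (au r) /\
    has_p_laplacian p v (r *: e1) (av r).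
  move=> /axis[re pr]; have := eqs _ pr.
  by rewrite (enorm_grad_radial i00 cu ru pr) re.
have f0 := derive1_profile_gt0 i00 N2 p1 cu ru ncu
  (fun r _ => mulr_ge0 (powR_ge0 _ _) (powR_ge0 _ _)) (fun r h => (lap r h).1).
have w0 := derive1_profile_gt0 i00 N2 p1 cv rv ncv
  (fun r _ => mulr_ge0 (powR_ge0 _ _) (powR_ge0 _ _)) (fun r h => (lap r h).2).
apply: (@radial_asymptotics R p m q alpha beta N.-1%:R f (profile v) w) => //.
- by move=> r /axis[_ [br _]]; exact: (pos _ br).2.
- move=> r /andP[r0 r1]; apply: (is_derive_profile i00 cv).
  by rewrite gtr0_norm.
- move=> r r01; apply: (is_derive_flux_pow p1 r01 f0).
  have := radial_p_laplacian i00 cu ru r01 (lap r r01).1; congr is_derive.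
  by rewrite flux_pos ?f0// /au gtr0_norm// f0.
- move=> r r01; apply: (is_derive_flux_pow p1 r01 w0).
  have := radial_p_laplacian i00 cv rv r01 (lap r r01).2; congr is_derive.
  by rewrite flux_pos ?w0// /av gtr0_norm// f0.
Qed.
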